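(* For any integer $k\ge 2$, the polynomials $P_k(x)=vA(x)\,\mathrm{adj}(I-A(x))\,u^T$ and $Q_k(x)=\det(I-A(x))$ are coprime in $K[x]$, where $K=\mathbb{C}(b)$.
   Context: $A(x)=(a_{ij})$ is the $(k-1)\times(k-1)$ matrix with $a_{ij}=b^kx^j$ if $i+j\ge k$ and $a_{ij}=0$ otherwise; $I$ is the identity matrix; $\mathrm{adj}$ denotes the adjugate matrix; $v=(b^kx,b^kx^2,\ldots,b^kx^{k-1})$ and $u=(1,\ldots,1)$ are row vectors of length $k-1$, and $u^T$ is the transpose of $u$. Here $b$ is an indeterminate. *)

(* Defs.v *)
From HB Require Import structures.
From mathcomp Require Import all_boot all_order all_algebra.
From mathcomp Require Import complex reals.
Set Implicit Arguments.
Unset Strict Implicit.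
Unset Printing Implicit Defensive.
Import GRing.Theory.
Local Open Scope ring_scope.

(* Ordinals are 0-based: the indices i, j = 1, ..., k-1 are i.+1, j.+1 here. *)
Section Def.
Variable K : fieldType.
Variables (b : K) (k : nat).

Definition matA : 'M[{poly K}]_(k - 1) :=
  \matrix_(i < k - 1, j < k - 1)
    if (k <= i.+1 + j.+1)%N then (b ^+ k)%:P * 'X^(j.+1) else 0.

Definition vecv : 'rV[{poly K}]_(k - 1) :=
  \row_(j < k - 1) ((b ^+ k)%:P * 'X^(j.+1)).

Definition vecu : 'rV[{poly K}]_(k - 1) := const_mx 1.

Definition numP : {poly K} :=
  (vecv *m matA *m \adj (1%:M - matA) *m vecu^T) ord0 ord0.

Definition denQ : {poly K} := \det (1%:M - matA).

End Def.

(* The field C(b), with C = R[i], and its indeterminate b. *)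
Definition ratfunC (R : realType) : fieldType := {fraction {poly R[i]}}.

Definition indet_b (R : realType) : ratfunC R := tofrac ('X : {poly R[i]}).

(* Main.v *)
Require Import Defs.
From HB Require Import structures.
From mathcomp Require Import all_boot all_order all_algebra.
From mathcomp Require Import complex reals.
From mathcomp Require Import fieldext boolp zify.
Import GRing.Theory.
Local Open Scope ring_scope.

(** Write [w] for the vector [v] and [N = w adj(I - A) u^T].  Since
    [w (I - A) adj(I - A) u^T = Q w u^T], one has [P = N - Q w u^T], and the
    matrix determinant lemma gives [det (I - A + u^T w) = Q + N].  Hence a common
    root of [P] and [Q] in an extension field makes both [I - A] and
    [I - A + u^T w] singular there; let [p] and [r] be nonzero column vectors
    killed by them.  As [diag(w) A] is symmetric, the row [p^T diag(w)] is
    killed by [I - A] and has inner product [w p] with [u], so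
    [(w p) (w r) = 0].  Hence [p] or [r] is a nonzero vector [y] with [A y = y]
    and [w y = 0].  But the tail sums [S m] of [w y] satisfy [y_i = S (n - 1 - i)],
    which propagates [S 0 = S n = 0] inwards from both ends and forces [y = 0]. *)

(** The weights [w] are arbitrary, so that the image of [A] under evaluation at a root keeps this
    shape. *)
Definition antitriangular_mx {R : pzRingType} {n : nat} (w : 'rV[R]_n) : 'M[R]_n :=
  \matrix_(i, j) if (n <= (i + j).+1)%N then w 0 j else 0.

Lemma antitriangular_fixed_eq0 (R : pzRingType) (n : nat) (w : 'rV[R]_n)
    (y : 'cV[R]_n) :
  antitriangular_mx w *m y = y -> w *m y = 0 -> y = 0.
Proof.
move=> Ay wy; pose S m := \sum_(j < n | (m <= j)%N) w 0 j * y j 0.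
have yE (i : 'I_n) : y i 0 = S (n - i.+1)%N.
  rewrite -{1}Ay mxE /S [RHS]big_mkcond; apply: eq_bigr => j _; rewrite mxE.
  have -> : (n <= (i + j).+1)%N = (n - i.+1 <= j)%N by lia.
  by case: ifP => // _; rewrite mul0r.
have S0 : S 0%N = 0.
  by have /matrixP/(_ 0 0) := wy; rewrite !mxE.
have Sn : S n = 0.
  by apply: big_pred0 => j; apply/negbTE; rewrite -ltnNge.
have Srec (m : 'I_n) : S m = w 0 m * S (n - m.+1)%N + S m.+1.
  rewrite {1}/S (bigD1 m) //= yE; congr (_ + _); apply: eq_bigl => j.
  by rewrite ltn_neqAle andbC eq_sym.
(* [Srec] at index [n - m.+1] gives [S (n - m.+1) = 0]; then [Srec] at [m] gives [S m.+1 = 0]. *)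
have Sends m : (m <= n)%N -> S m = 0 /\ S (n - m)%N = 0.
  elim: m => [|m IHm] lt_mn; first by rewrite subn0.
  have [Sm Snm] := IHm (ltnW lt_mn).
  have Snm1 : S (n - m.+1)%N = 0.
    have lt_n : (n - m.+1 < n)%N by lia.
    have := Srec (Ordinal lt_n); rewrite /=.
    have -> : (n - (n - m.+1).+1 = m)%N by lia.
    have -> : ((n - m.+1).+1 = n - m)%N by lia.
    by rewrite Sm Snm mulr0 addr0.
  split=> //; have := Srec (Ordinal lt_mn).
  by rewrite /= Sm Snm1 mulr0 add0r.
by apply/colP => i; rewrite yE mxE; have [] := Sends i.+1 (ltn_ord i).
Qed.

Lemma det0_colP (F : fieldType) (n : nat) (M : 'M[F]_n) :
  \det M = 0 -> exists2 y : 'cV[F]_n, y != 0 & M *m y = 0.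
Proof.
rewrite -det_tr => /eqP/det0P[y nz_y yM]; exists y^T; first by rewrite trmx_eq0.
by apply: trmx_inj; rewrite trmx_mul trmxK yM trmx0.
Qed.

Lemma antitriangular_det_neq0 (F : fieldType) (n : nat) (w : 'rV[F]_n) :
  \det (1%:M - antitriangular_mx w) = 0 ->
  \det (1%:M - antitriangular_mx w + (const_mx 1 : 'rV_n)^T *m w) <> 0.
Proof.
set M := _ - _; set u := const_mx 1.
move=> /det0_colP[p nz_p Mp] /det0_colP[r nz_r Mr].
have fixed (y : 'cV_n) : M *m y = 0 -> antitriangular_mx w *m y = y.
  by rewrite mulmxBl mul1mx => /subr0_eq.
have [q qE] : exists q : 'rV_n, forall j, q 0 j = p j 0 * w 0 j.
  by exists (\row_j (p j 0 * w 0 j)) => j; rewrite mxE.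
(* The entries [w_i A_ij] are [w_i w_j] or zero, under a condition symmetric in [i] and [j]. *)
have qM : q *m M = 0.
  apply/rowP => j; rewrite mulmxBr mulmx1 !mxE.
  rewrite qE -{1}[p](fixed _ Mp) mxE mulr_suml -sumrB big1 // => i _.
  rewrite qE !mxE addnC; case: ifP => _; last by rewrite mul0r mulr0 mul0r subrr.
  by rewrite [w 0 i * _]mulrC subrr.
have qu : q *m u^T = w *m p.
  apply/matrixP => i j; rewrite !ord1 !mxE; apply: eq_bigr => l _.
  by rewrite qE !mxE mulr1 mulrC.
(* Multiply the equation for [r] by [q] on the left; the term [q M r] drops out. *)
have : (w *m p) *m (w *m r) = 0.
  have := congr1 (mulmx q) Mr.
  by rewrite mulmx0 mulmxA mulmxDr qM add0r (mulmxA q) qu -mulmxA.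
rewrite [w *m p]mx11_scalar mul_scalar_mx => /eqP; rewrite scaler_eq0.
case/orP => /eqP wy0.
  case/eqP: nz_p; apply: antitriangular_fixed_eq0 (fixed _ Mp) _.
  by rewrite [LHS]mx11_scalar wy0 raddf0.
case/eqP: nz_r; apply: antitriangular_fixed_eq0 (wy0); apply: fixed.
by move: Mr; rewrite mulmxDl -mulmxA wy0 mulmx0 addr0.
Qed.

(** Two block triangular multipliers evaluate the determinant of the bordered matrix [B]. The second
    one uses the adjugate in place of an inverse, at the price of a factor [\det M] that is
    cancelled. *)
Lemma det_add_rank1 (D : idomainType) (n : nat) (M : 'M[D]_n) (c : 'cV[D]_n)
    (w : 'rV[D]_n) :
  \det M != 0 -> \det (M + c *m w) = \det M + (w *m \adj M *m c) 0 0.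
Proof.
move=> nzM; pose B := block_mx M c (- w) (1%:M : 'M_1).
have detB : \det B = \det (M + c *m w).
  have := det_mulmx B (block_mx 1%:M 0 w 1%:M).
  rewrite mulmx_block !(mulmx1, mulmx0, mul1mx, mul0mx, add0r, addNr).
  by rewrite det_ublock det_lblock !det1 !mulr1 => ->.
apply: (mulfI nzM); rewrite -detB.
have := det_mulmx B (block_mx 1%:M (- (\adj M *m c)) 0 (\det M)%:M).
rewrite mulmx_block !(mulmx1, mulmx0, mul1mx, mul0mx, addr0).
rewrite mulmxN mulNmx mulmxN opprK mulmxA mul_mx_adj mul_scalar_mx mul_mx_scalar addNr.
rewrite det_lblock det_ublock !det1 det_scalar1 mul1r => detBM.
rewrite mulrC -detBM; congr (_ * _).
by rewrite det_mx11 mxE mulmxA [(\det M)%:M 0 0]mxE eqxx mulr1n addrC.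
Qed.

Lemma irreducible_factor (F : fieldType) (p : {poly F}) :
  (1 < size p)%N -> exists2 d, irreducible_poly d & d %| p.
Proof.
have [m] := ubnP (size p); elim: m p => // m IHm p le_pm p_gt1.
have [irr_p|] := EM (irreducible_poly p); first by exists p.
move=> red_p; apply: contrapT => no_d; apply: red_p; split=> // q q_neq1 q_p.
have nz_p : p != 0 by rewrite -size_poly_gt0 ltnW.
have nz_q : q != 0 by apply: contraTneq q_p => ->; rewrite dvd0p.
have q_gt1 : (1 < size q)%N.
  by rewrite ltn_neqAle eq_sym q_neq1 size_poly_gt0.
(* A divisor of full size is associate to [p]; a smaller one has an irreducible factor by
   induction. *)
rewrite -dvdp_size_eqp // eqn_leq dvdp_leq //= leqNgt; apply/negP => lt_qp.
have [|d irr_d d_q] := IHm q _ q_gt1; first exact: leq_trans lt_qp _.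
by apply: no_d; exists d => //; apply: dvdp_trans q_p.
Qed.

Lemma coprimep_no_common_root (F : fieldType) (p q : {poly F}) :
  q != 0 ->
  (forall (L : fieldExtType F) (z : L),
     root (map_poly (in_alg L) p) z -> ~~ root (map_poly (in_alg L) q) z) ->
  coprimep p q.
Proof.
move=> nz_q noroot; apply: contraT => g_neq1.
have [|d irr_d] := @irreducible_factor _ (gcdp p q).
  by rewrite ltn_neqAle eq_sym g_neq1 size_poly_gt0 gcdp_eq0 (negPf nz_q) andbF.
rewrite dvdp_gcd => /andP[d_p d_q].
have [L _ [z dz _]] := irredp_FAdjoin irr_d.
have dvd_root f : d %| f -> root (map_poly (in_alg L) f) z.
  by move=> d_f; apply: (root_dvdp _ dz); rewrite dvdp_map.
by have /negP[] := noroot L z (dvd_root _ d_p); apply: dvd_root.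
Qed.

Section Coprimality.

Variables (K : fieldType) (b : K) (k : nat).

Let u := vecu K k.
Let v := vecv b k.

Lemma matAE : matA b k = antitriangular_mx v.
Proof.
apply/matrixP => i j; rewrite !mxE.
by have -> : (k <= i.+1 + j.+1)%N = (k - 1 <= (i + j).+1)%N by lia.
Qed.

(** Every entry of [A] is divisible by ['X], so the determinant takes the value 1 at 0. *)
Lemma denQ_neq0 : denQ b k != 0.
Proof.
apply/eqP => /(congr1 (horner_eval 0)); rewrite rmorph0 -det_map_mx.
rewrite map_mxB map_mx1 (_ : map_mx _ (matA b k) = 0); last first.
  apply/matrixP => i j; rewrite !mxE; case: ifP => _; last exact: rmorph0.
  by rewrite /= /horner_eval hornerM hornerXn expr0n mulr0.
by rewrite subr0 det1 => /eqP; rewrite oner_eq0.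
Qed.

Lemma det_denQ_numP :
  \det (1%:M - matA b k + u^T *m v) = denQ b k * (1 + (v *m u^T) 0 0) + numP b k.
Proof.
rewrite det_add_rank1 ?denQ_neq0 // -/(denQ b k) mulrDr mulr1 -addrA; congr (_ + _).
set B := \adj _.
(* Splitting off [v A adj(I - A)] makes [numP] appear. *)
have -> : v *m B = denQ b k *: v + v *m matA b k *m B.
  have <- : v *m ((1%:M - matA b k) *m B) = denQ b k *: v.
    by rewrite mul_mx_adj mul_mx_scalar.
  by rewrite mulmxBl mul1mx mulmxBr mulmxA subrK.
by rewrite mulmxDl -scalemxAl mxE [X in X + _]mxE.
Qed.

Lemma numP_denQ_not_both_eq0 (F : fieldType) (phi : {rmorphism {poly K} -> F}) :
  phi (numP b k) = 0 -> phi (denQ b k) != 0.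
Proof.
move=> P0; apply/eqP => Q0.
have mapA : map_mx phi (1%:M - matA b k) = 1%:M - antitriangular_mx (map_mx phi v).
  rewrite map_mxB map_mx1 matAE; congr (_ - _); apply/matrixP => i j.
  by rewrite !mxE; case: ifP => // _; exact: rmorph0.
have := @antitriangular_det_neq0 _ _ (map_mx phi v).
rewrite -mapA (_ : const_mx 1 = map_mx phi u); last first.
  by rewrite map_const_mx rmorph1.
rewrite map_trmx -map_mxM -map_mxD !det_map_mx det_denQ_numP rmorphD rmorphM.
by rewrite P0 Q0 mul0r addr0 => /(_ erefl).
Qed.

Lemma coprimep_numP_denQ : coprimep (numP b k) (denQ b k).
Proof.
apply: coprimep_no_common_root denQ_neq0 _ => L z /eqP Pz.
(* The morphism is evaluation at [z] after extending scalars to [L]. *)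
exact: (@numP_denQ_not_both_eq0 L (horner_eval z \o map_poly (in_alg L))).
Qed.

End Coprimality.

Theorem theorem2p10 (R : realType) (k : nat) (hk : (2 <= k)%N) :
  coprimep (numP (indet_b R) k) (denQ (indet_b R) k).
Proof. exact: coprimep_numP_denQ. Qed.
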